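(* Let $A\in\mathbb{C}^{m\times n}$, $0\neq W\in\mathbb{C}^{n\times m}$ and $q\in\mathbb{N}\cup\{0\}$. Then the following statements hold: (i) $A^{\diamond_q,W}=\bigl(W[(AW)^{\diamond_q}]^\dagger\bigr)^\dagger$. (ii) $\mathcal{R}(A^{\diamond_q,W})=\mathcal{R}(P_{(AW)^q}(WAW)^* )$ and $\mathcal{N}(A^{\diamond_q,W})=\mathcal{N}(P_{(AW)^q}(WAW)^* )$. (iii) $\mathcal{R}(A^{\diamond_q,W})=\mathcal{R}\bigl(([(AW)^{\diamond_q}]^\dagger)^*W^*\bigr)$ and $\mathcal{N}(A^{\diamond_q,W})=\mathcal{N}\bigl(([(AW)^{\diamond_q}]^\dagger)^*W^*\bigr)$. (iv) $\mathcal{R}(A^{\diamond_q,W})=\mathcal{R}\bigl([((AW)^q)^\dagger]^*[(AW)^{q+1}]^*W^*\bigr)$ and $\mathcal{N}(A^{\diamond_q,W})=\mathcal{N}\bigl([(AW)^{q+1}]^*W^*\bigr)$. (v) $\mathcal{R}(A^{\diamond_q,W})\subseteq\mathcal{R}((AW)^q)$. (vi) $P_{(AW)^q}A^{\diamond_q,W}=A^{\diamond_q,W}$.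
   Context: $B^*$ is the conjugate transpose, $B^\dagger$ the Moore-Penrose inverse, $\mathcal{R}(B)$ the column space and $\mathcal{N}(B)$ the null space of $B$; $P_B:=BB^\dagger$ is the orthogonal projector onto $\mathcal{R}(B)$. For square $B$, $B^0=I$. The $W$-weighted $q$-BT inverse $A^{\diamond_q,W}$ is the unique $X\in\mathbb{C}^{m\times n}$ satisfying $XWAWX=X$, $XWA=(WAWP_{(AW)^q})^\dagger WA$, $AWX=AW(WAWP_{(AW)^q})^\dagger$; explicitly $A^{\diamond_q,W}=(WAWP_{(AW)^q})^\dagger$. For a square matrix $B$, the $q$-BT inverse is $B^{\diamond_q}:=(BP_{B^q})^\dagger$. *)

(* Defs.v *)
From mathcomp Require Import all_boot all_order all_algebra.
From mathcomp Require Import complex.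
From mathcomp Require Import boolp classical_sets reals.

Set Implicit Arguments.
Unset Strict Implicit.
Unset Printing Implicit Defensive.

Import Order.TTheory GRing.Theory Num.Theory.

Local Open Scope classical_set_scope.
Local Open Scope ring_scope.
Local Open Scope sesquilinear_scope.

Section Spaces.
Variable C : numClosedFieldType.

(* MathComp's mxalgebra works with row spaces; here matrices act on the left
   on column vectors. *)
Definition colspace m n (B : 'M[C]_(m, n)) : set 'cV[C]_m :=
  range (fun x : 'cV[C]_n => B *m x).

Definition nullspace m n (B : 'M[C]_(m, n)) : set 'cV[C]_n :=
  [set x | B *m x = 0].

End Spaces.

Section MoorePenrose.
Variable C : numClosedFieldType.

Definition penrose m n (B : 'M[C]_(m, n)) (X : 'M[C]_(n, m)) : bool :=
  [&& B *m X *m B == B,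
      X *m B *m X == X,
      (B *m X)^t* == B *m X
    & (X *m B)^t* == X *m B].

Lemma ctmx_mul m n p (A : 'M[C]_(m, n)) (B : 'M[C]_(n, p)) :
  (A *m B)^t* = B^t* *m A^t*.
Proof. by rewrite trmx_mul map_mxM. Qed.

Lemma ctmx_inv n (A : 'M[C]_n) : (invmx A)^t* = invmx (A^t*).
Proof. by rewrite trmx_inv map_invmx. Qed.

Lemma gram_unit m n (G : 'M[C]_(m, n)) : row_free G -> G *m G^t* \in unitmx.
Proof.
move=> Gfree; rewrite -row_free_unit; apply: inj_row_free => v v0.
suff : v *m G = 0 by move/eqP; rewrite mulmx_free_eq0 // => /eqP.
apply/eqP/negPn/negP => /dotmx_is_dotmx.
by rewrite dotmxE ctmx_mul !mulmxA -(mulmxA v) v0 mul0mx mxE ltxx.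
Qed.

Lemma penrose_factor m n r (F : 'M[C]_(m, r)) (G : 'M[C]_(r, n)) :
  row_full F -> row_free G -> exists X, penrose (F *m G) X.
Proof.
move=> Ffull Gfree; have uG := gram_unit Gfree.
have uF : F^t* *m F \in unitmx.
  rewrite -[X in _ *m X]trmxCK; apply: gram_unit.
  by rewrite /row_free mxrank_map mxrank_tr.
pose GG := G *m G^t*; pose FF := F^t* *m F.
have GGh : (invmx GG)^t* = invmx GG by rewrite ctmx_inv /GG ctmx_mul trmxCK.
have FFh : (invmx FF)^t* = invmx FF by rewrite ctmx_inv /FF ctmx_mul trmxCK.
pose X := G^t* *m invmx GG *m invmx FF *m F^t*.
have BX : F *m G *m X = F *m invmx FF *m F^t*.
  by rewrite /X !mulmxA -(mulmxA F G) -/GG mulmxK.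
have XB : X *m (F *m G) = G^t* *m invmx GG *m G.
  by rewrite /X !mulmxA -(mulmxA _ _ F) -/FF mulmxKV.
exists X; apply/and4P; split; apply/eqP.
- by rewrite BX !mulmxA -(mulmxA _ _ F) -/FF mulmxKV.
- by rewrite XB /X !mulmxA -(mulmxA _ G) -/GG mulmxKV.
- by rewrite BX !ctmx_mul trmxCK FFh mulmxA.
- by rewrite XB !ctmx_mul trmxCK GGh mulmxA.
Qed.

Lemma penrose_exists m n (B : 'M[C]_(m, n)) : exists X, penrose B X.
Proof.
have [X] := penrose_factor (col_base_full B) (row_base_free B).
by rewrite mulmx_base; exists X.
Qed.

Lemma penrose_uniq m n (B : 'M[C]_(m, n)) X Y :
  penrose B X -> penrose B Y -> X = Y.
Proof.
move=> /and4P[/eqP X1 /eqP X2 /eqP X3 /eqP X4].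
move=> /and4P[/eqP Y1 /eqP Y2 /eqP Y3 /eqP Y4].
have BXY : B *m X = B *m Y.
  by rewrite -X3 -[in LHS]Y1 -mulmxA ctmx_mul X3 Y3 !mulmxA X1.
have XYB : X *m B = Y *m B.
  by rewrite -X4 -[in LHS]Y1 !mulmxA -[_ *m Y *m B]mulmxA ctmx_mul X4 Y4
             -mulmxA (mulmxA B) X1.
by rewrite -X2 XYB -mulmxA BXY mulmxA Y2.
Qed.

(* The Moore-Penrose inverse, characterized by penrose_exists and
   penrose_uniq. *)
Definition mpinv m n (B : 'M[C]_(m, n)) : 'M[C]_(n, m) :=
  xchoose (penrose_exists B).

Lemma mpinvP m n (B : 'M[C]_(m, n)) : penrose B (mpinv B).
Proof. exact: xchooseP. Qed.

(* The orthogonal projector onto the column space of B. *)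
Definition rproj m n (B : 'M[C]_(m, n)) : 'M[C]_m := B *m mpinv B.

End MoorePenrose.

Section BT.
Variable C : numClosedFieldType.

(* The q-BT inverse of a square matrix; B ^+ 0 = 1%:M. *)
Definition qBT m (q : nat) (B : 'M[C]_m) : 'M[C]_m :=
  mpinv (B *m rproj (B ^+ q)).

Definition wqBT_spec m n (q : nat) (A : 'M[C]_(m, n)) (W : 'M[C]_(n, m))
    (X : 'M[C]_(m, n)) : bool :=
  let Y := mpinv (W *m A *m W *m rproj ((A *m W) ^+ q)) in
  [&& X *m W *m A *m W *m X == X,
      X *m W *m A == Y *m W *m A
    & A *m W *m X == A *m W *m Y].

Lemma wqBT_specE m n q (A : 'M[C]_(m, n)) (W : 'M[C]_(n, m)) X :
  wqBT_spec q A W X =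
  (X == mpinv (W *m A *m W *m rproj ((A *m W) ^+ q))).
Proof.
rewrite /wqBT_spec; set P := rproj _; set Y := mpinv _.
have /and4P[_ /eqP P2 /eqP P3 _] := mpinvP ((A *m W) ^+ q).
have /and4P[_ /eqP Y2 _ /eqP Y4] := mpinvP (W *m A *m W *m P).
rewrite -/Y in Y2 Y4; have PP : P *m P = P.
  by rewrite /P /rproj -mulmxA (mulmxA (mpinv _)) P2.
have PY : P *m Y = Y.
  suff -> : Y = P *m ((W *m A *m W)^t* *m Y^t* *m Y) by rewrite mulmxA PP.
  by rewrite -[LHS]Y2 -Y4 !(ctmx_mul Y, ctmx_mul _ P) P3 -/P !mulmxA.
have YY : Y *m W *m A *m W *m Y = Y.
  by rewrite -[RHS]Y2 -[RHS]mulmxA -[_ *m P *m Y]mulmxA PY !mulmxA.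
apply/and3P/eqP => [[/eqP X1 /eqP X2 /eqP X3]|->]; last by rewrite YY !eqxx.
by rewrite -X1 X2 -!mulmxA (mulmxA A) X3 !mulmxA YY.
Qed.

Lemma wqBT_exists m n q (A : 'M[C]_(m, n)) (W : 'M[C]_(n, m)) :
  exists X, wqBT_spec q A W X.
Proof. by eexists; rewrite wqBT_specE. Qed.

(* The W-weighted q-BT inverse of A; wqBT_specE gives uniqueness of the
   solution. *)
Definition wqBT m n (q : nat) (W : 'M[C]_(n, m)) (A : 'M[C]_(m, n)) :
    'M[C]_(m, n) :=
  xchoose (wqBT_exists q A W).

Lemma wqBTE m n q (W : 'M[C]_(n, m)) (A : 'M[C]_(m, n)) :
  wqBT q W A = mpinv (W *m A *m W *m rproj ((A *m W) ^+ q)).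
Proof. by apply/eqP; rewrite -wqBT_specE; exact: xchooseP. Qed.

End BT.

(* Main.v *)
Require Import Defs.
From mathcomp Require Import all_boot all_order all_algebra.
From mathcomp Require Import complex.
From mathcomp Require Import boolp classical_sets reals.

Import Order.TTheory GRing.Theory Num.Theory.

Local Open Scope classical_set_scope.
Local Open Scope ring_scope.
Local Open Scope sesquilinear_scope.

(** With B = AW, P the orthogonal projector onto the range of B^q and
    K = W B P, the weighted inverse is by definition the Moore-Penrose inverse
    of K, and everything follows from reading K^* in several ways.

    Taking the Moore-Penrose inverse twice gives back the matrix, so the
    pseudo-inverse of the q-BT inverse of B is just B P. Hence
    K = W (B P), which is (i).

    A pseudo-inverse has the same range and the same null space as the conjugate
    transpose ([colspace_mpinv], [nullspace_mpinv]), so the ranges and null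
    spaces in (ii)-(iv) are those of K^*. For (ii) and (iii) the matrix on the
    right is K^* itself, expanded with P^* = P or with K = W (B P). For (iv),
    write P = M M^+ with M = B^q: then K = (W B^(q+1)) M^+ gives the range,
    while M^+ can be removed for the null space because K M = W B^(q+1) by
    the identity M M^+ M = M.

    Finally K^* = P (WAW)^* starts with P, so its range, which is that of the
    weighted inverse, is contained in the range of P, that is, of B^q; this is
    (v), and (vi) says the same thing since P fixes its range pointwise. *)

Section MoorePenroseTheory.
Context {C : numClosedFieldType}.

Lemma colspace_mulmx {m n p} (B : 'M[C]_(m, n)) (Y : 'M[C]_(n, p)) :
  colspace (B *m Y) `<=` colspace B.
Proof. by move=> _ [x _ <-]; exists (Y *m x) => //; rewrite mulmxA. Qed.

Lemma nullspace_mulmx {m n p} (Y : 'M[C]_(p, m)) (B : 'M[C]_(m, n)) :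
  nullspace B `<=` nullspace (Y *m B).
Proof. by rewrite /nullspace => x /= Bx0; rewrite -mulmxA Bx0 mulmx0. Qed.

Lemma mulmx_mpinvK {m n} (B : 'M[C]_(m, n)) : B *m mpinv B *m B = B.
Proof. by have /and4P[/eqP] := mpinvP B. Qed.

Lemma mpinv_mulmxK {m n} (B : 'M[C]_(m, n)) :
  mpinv B *m B *m mpinv B = mpinv B.
Proof. by have /and4P[_ /eqP] := mpinvP B. Qed.

Lemma rproj_ctmx {m n} (B : 'M[C]_(m, n)) : (rproj B)^t* = rproj B.
Proof. by have /and4P[_ _ /eqP] := mpinvP B. Qed.

Lemma mpinv_mulmx_ctmx {m n} (B : 'M[C]_(m, n)) :
  (mpinv B *m B)^t* = mpinv B *m B.
Proof. by have /and4P[_ _ _ /eqP] := mpinvP B. Qed.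

(** The Penrose equations are symmetric in the two matrices. *)
Lemma mpinvK {m n} (B : 'M[C]_(m, n)) : mpinv (mpinv B) = B.
Proof.
apply: penrose_uniq (mpinvP _) _.
by have /and4P[B1 B2 B3 B4] := mpinvP B; apply/and4P.
Qed.

(** Each of the matrices [mpinv B] and [B^t*] is a left multiple and a right
    multiple of the other, because the projectors [B *m mpinv B] and
    [mpinv B *m B] are Hermitian. *)
Lemma colspace_mpinv {m n} (B : 'M[C]_(m, n)) :
  colspace (mpinv B) = colspace (B^t*).
Proof.
apply/seteqP; split.
  rewrite -[X in colspace X]mpinv_mulmxK -mpinv_mulmx_ctmx ctmx_mul -mulmxA.
  exact: colspace_mulmx.
rewrite -{1}[B]mulmx_mpinvK -mulmxA ctmx_mul mpinv_mulmx_ctmx -mulmxA.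
exact: colspace_mulmx.
Qed.

Lemma nullspace_mpinv {m n} (B : 'M[C]_(m, n)) :
  nullspace (mpinv B) = nullspace (B^t*).
Proof.
apply/seteqP; split.
  rewrite -{2}[B]mulmx_mpinvK ctmx_mul -/(rproj B) rproj_ctmx /rproj mulmxA.
  exact: nullspace_mulmx.
rewrite -[X in _ `<=` nullspace X]mpinv_mulmxK -mulmxA -/(rproj B) -rproj_ctmx.
rewrite /rproj ctmx_mul mulmxA.
exact: nullspace_mulmx.
Qed.

Lemma rproj_id {m n} (B : 'M[C]_(m, n)) (x : 'cV[C]_m) :
  colspace B x -> rproj B *m x = x.
Proof. by move=> [y _ <-]; rewrite mulmxA mulmx_mpinvK. Qed.

(** Equality of matrices is tested on columns, and the columns of [X] span its
    range. *)
Lemma rproj_mulmx_id {m n p} (B : 'M[C]_(m, n)) (X : 'M[C]_(m, p)) :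
  colspace X `<=` colspace B -> rproj B *m X = X.
Proof.
move=> XB; apply/matrixP => i j.
have /XB/rproj_id : colspace X (col j X) by exists (delta_mx j 0); rewrite ?colE.
by rewrite !colE mulmxA -!colE => /colP/(_ i); rewrite !mxE.
Qed.

End MoorePenroseTheory.

Theorem theorem2p11 (R : realType) (m n q : nat)
    (A : 'M[R[i]]_(m, n)) (W : 'M[R[i]]_(n, m)) (W0 : W != 0) :
  (* (i) *)
  wqBT q W A = mpinv (W *m mpinv (qBT q (A *m W))) /\
  (* (ii) *)
  (colspace (wqBT q W A) =
     colspace (rproj ((A *m W) ^+ q) *m (W *m A *m W)^t*) /\
   nullspace (wqBT q W A) =
     nullspace (rproj ((A *m W) ^+ q) *m (W *m A *m W)^t*)) /\
  (* (iii) *)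
  (colspace (wqBT q W A) =
     colspace ((mpinv (qBT q (A *m W)))^t* *m W^t*) /\
   nullspace (wqBT q W A) =
     nullspace ((mpinv (qBT q (A *m W)))^t* *m W^t*)) /\
  (* (iv) *)
  (colspace (wqBT q W A) =
     colspace ((mpinv ((A *m W) ^+ q))^t* *m ((A *m W) ^+ q.+1)^t* *m W^t*) /\
   nullspace (wqBT q W A) =
     nullspace (((A *m W) ^+ q.+1)^t* *m W^t*)) /\
  (* (v) *)
  colspace (wqBT q W A) `<=` colspace ((A *m W) ^+ q) /\
  (* (vi) *)
  rproj ((A *m W) ^+ q) *m wqBT q W A = wqBT q W A.
Proof.
set B := A *m W; set M := B ^+ q; set P := rproj M.
pose K := W *m (B *m P).
have defX : wqBT q W A = mpinv K by rewrite wqBTE /K /P /M /B !mulmxA.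
have defBP : mpinv (qBT q B) = B *m P by rewrite /qBT mpinvK.
have K_ii : K^t* = P *m (W *m A *m W)^t*.
  by rewrite -[P]rproj_ctmx -ctmx_mul /K /B !mulmxA.
have K_iii : K^t* = (B *m P)^t* *m W^t* by rewrite /K ctmx_mul.
have K_iv : K^t* = (mpinv M)^t* *m (B ^+ q.+1)^t* *m W^t*.
  by rewrite -mulmxA -!ctmx_mul exprS /K /P /rproj -!mulmxA.
have KM : M^t* *m K^t* = (B ^+ q.+1)^t* *m W^t*.
  have PM : P *m M = M := mulmx_mpinvK M.
  by rewrite -!ctmx_mul /K -(mulmxA W) -(mulmxA B) PM exprS.
have subX : colspace (mpinv K) `<=` colspace M.
  rewrite colspace_mpinv K_ii /P /rproj -mulmxA; exact: colspace_mulmx.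
rewrite defX defBP colspace_mpinv nullspace_mpinv.
split; first by [].
split; first by rewrite K_ii.
split; first by rewrite K_iii.
split; last by split; [rewrite -colspace_mpinv | exact: rproj_mulmx_id].
split; first by rewrite K_iv.
apply/seteqP; split; first by rewrite -KM; exact: nullspace_mulmx.
by rewrite K_iv -mulmxA; exact: nullspace_mulmx.
Qed.
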